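(* For every network game with correlated preferences, every locally stable matching $M^*\subseteq E$ and every initial matching $M_0\subseteq E$ such that $M^*$ can be reached from $M_0$ by a finite sequence of local improvement steps, there exists a sequence of at most $O(|E|^3)$ local improvement steps leading from $M_0$ to $M^*$.
   Context: A network game consists of a set $V$ of players, a network $N=(V,L)$ whose links are unordered pairs of distinct players, and a set $E$ of potential matching edges. A state is a matching $M\subseteq E$. With correlated preferences each $e\in E$ has a weight $b(e)>0$ which is the utility of $e$ for both endpoints; unmatched players have utility $0$. In state $M$, two players are accessible if their distance in $(V,L\cup M)$ is at most $2$. A local blocking pair of $M$ is a pair $\{u,v\}\in E$ of accessible players each of which is unmatched or matched by an edge of strictly smaller weight than $\{u,v\}$. A locally stable matching is a matching with no local blocking pair. A local improvement step picks a local blocking pair $\{u,v\}$, adds it to $M$ and removes all edges of $M$ incident to $u$ or $v$. *)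

(* Defs.v *)
From mathcomp Require Import all_boot all_order all_algebra.
From mathcomp Require Import reals.
Set Implicit Arguments.
Unset Strict Implicit.
Unset Printing Implicit Defensive.

(* An edge is a two-element set of players. The weight function is total, but
   only its values on candidate edges are constrained or used. *)
Record network_game (R : realType) (V : finType) := NetworkGame {
  links : {set {set V}};
  candidates : {set {set V}};
  weight : {set V} -> R;
  links_pair : forall e, e \in links -> #|e| = 2;
  candidates_pair : forall e, e \in candidates -> #|e| = 2;
  weight_gt0 : forall e, e \in candidates -> (0 < weight e)%R
}.

Section Dynamics.
Context {R : realType} {V : finType} (G : network_game R V).
Implicit Types (M : {set {set V}}) (x u v : V).

Definition matching M : bool := (M \subset candidates G) && trivIset M.

Definition dist_le (A : {set {set V}}) (k : nat) u v : Prop :=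
  exists p : seq V,
    [/\ path [rel x y | [set x; y] \in A] u p, last u p = v & size p <= k].

Definition accessible M u v : Prop := dist_le (links G :|: M) 2 u v.

Definition would_improve M x (e : {set V}) : Prop :=
  x \notin cover M \/
  exists f : {set V}, [/\ f \in M, x \in f & (weight G f < weight G e)%R].

Definition local_blocking_pair M u v : Prop :=
  [/\ [set u; v] \in candidates G, accessible M u v,
      would_improve M u [set u; v] & would_improve M v [set u; v]].

Definition locally_stable M : Prop :=
  matching M /\ forall u v, ~ local_blocking_pair M u v.

Definition resolve M u v : {set {set V}} :=
  [set u; v] |: [set f in M | (u \notin f) && (v \notin f)].

Definition local_improvement_step M M' : Prop :=
  exists u v, local_blocking_pair M u v /\ M' = resolve M u v.

(* The index is the exact number of steps. *)
Inductive improvement_sequence : nat -> {set {set V}} -> {set {set V}} -> Prop :=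
| improvement_nil M : improvement_sequence 0 M M
| improvement_cons n M M' M'' :
    local_improvement_step M M' -> improvement_sequence n M' M'' ->
    improvement_sequence n.+1 M M''.

End Dynamics.

(* Main.v *)
Require Import Defs.
From mathcomp Require Import all_boot all_order all_algebra.
From mathcomp Require Import reals.
From mathcomp Require Import zify.
Set Implicit Arguments.
Unset Strict Implicit.
Unset Printing Implicit Defensive.

(** Trace a given improvement sequence and regard each created edge as a fresh
    instance.  Besides links, the creation of an instance needs at most one
    matching edge, its predecessor, which is strictly lighter and is destroyed
    by that very creation.  Keep the instances in [M0] and [Mstar], the
    destroyer of every kept instance of [M0] (and the destroyers of these,
    and so on), and the chains of predecessors of all of these.  The kept
    instances are closed under taking destroyers and predecessors, so their
    creations, in the original order, again form an improvement sequence from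
    [M0] to [Mstar].  Both kinds of chains are strictly monotone in weight,
    hence of length at most [|E|], so O(|E|^3) steps remain. *)

Lemma leq_sum_setU (T : finType) (A B : {set T}) (F : T -> nat) :
  \sum_(x in A :|: B) F x <= \sum_(x in A) F x + \sum_(x in B) F x.
Proof.
rewrite (big_setID A) /= setUK leq_add2l setDUl setDv set0U.
by rewrite [leqRHS](big_setID A) /= leq_addl.
Qed.

Section Pruning.
Context {R : realType} {V : finType} (G : network_game R V).
Implicit Types (M A B P : {set {set V}}) (e f : {set V}) (u v w : V).

Lemma dist_le_sub A B k u v : A \subset B -> dist_le A k u v -> dist_le B k u v.
Proof.
move=> /subsetP sAB [p [hp lp sp]]; exists p; split=> //.
by apply: sub_path hp => x y /=; exact: sAB.
Qed.

Lemma trivIset_eq M e f u :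
  trivIset M -> e \in M -> f \in M -> u \in e -> u \in f -> e = f.
Proof.
move=> /trivIsetP tM eM fM ue uf; apply/eqP/negPn/negP=> nef.
by have /disjointFr/(_ ue) := tM _ _ eM fM nef; rewrite uf.
Qed.

Lemma would_improve_lt M u e f : trivIset M -> would_improve G M u e ->
  f \in M -> u \in f -> (weight G f < weight G e)%R.
Proof.
move=> tM [/negP nu fM uf|[g [gM ug lt_ge]] fM uf].
  by case: nu; apply/bigcupP; exists f.
by rewrite (trivIset_eq tM fM gM uf ug).
Qed.

(** Thinning out a matching can only destroy accessibility, never an incentive: an edge at [u] that
    survives in [A] was already in [M], hence lighter than [e]. *)
Lemma would_improve_sub A M u e : trivIset M -> A \subset M ->
  would_improve G M u e -> would_improve G A u e.
Proof.
move=> tM /subsetP sAM wM.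
have [/bigcupP[f fA uf]|nu] := boolP (u \in cover A); last by left.
right; exists f; split=> //.
exact: would_improve_lt tM wM (sAM _ fA) uf.
Qed.

(** For a candidate [e], bounds the number of edges in a strictly weight-decreasing chain of
    candidates from [e], such as its chain of predecessors. *)
Definition rank e : nat :=
  #|[set f in candidates G | (weight G f <= weight G e)%R]|.

Lemma rank_le e : rank e <= #|candidates G|.
Proof. by apply: subset_leq_card; apply/subsetP=> f; rewrite inE => /andP[]. Qed.

Lemma rank_lt e f : e \in candidates G -> (weight G f < weight G e)%R ->
  rank f < rank e.
Proof.
move=> eE lt_fe; apply: proper_card; apply/properP; split.
  apply/subsetP=> g; rewrite !inE => /andP[-> le_gf] /=.
  exact: Order.POrderTheory.ltW (Order.POrderTheory.le_lt_trans le_gf lt_fe).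
exists e; rewrite !inE eE ?Order.POrderTheory.lexx //=.
by rewrite Order.POrderTheory.lt_geF.
Qed.

(* [P] is empty or consists of the predecessor of [[set u; v]]. *)
Lemma blocking_pair_support M u v : trivIset M -> local_blocking_pair G M u v ->
  exists P, [/\ P \subset M, forall f, f \in P -> (u \in f) || (v \in f),
    \sum_(f in P) rank f < rank [set u; v] &
    forall A, P \subset A -> accessible G A u v].
Proof.
move=> tM [eE [p [hp lp sp]] wu wv].
set e := [set u; v] in eE wu wv *.
have rank_gt0 : 0 < rank e.
  by apply/card_gt0P; exists e; rewrite inE eE Order.POrderTheory.lexx.
have none : dist_le (links G) 2 u v -> exists P, [/\ P \subset M,
    forall f, f \in P -> (u \in f) || (v \in f),
    \sum_(f in P) rank f < rank e & forall A, P \subset A -> accessible G A u v].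
  move=> duv; exists set0; split; first exact: sub0set.
  - by move=> f; rewrite inE.
  - by rewrite big_set0.
  - by move=> A _; apply: dist_le_sub duv; exact: subsetUl.
have lightM f : f \in M -> (u \in f) || (v \in f) -> rank f < rank e.
  move=> fM /orP[uf|vf]; apply: rank_lt => //.
    exact: would_improve_lt tM wu fM uf.
  exact: would_improve_lt tM wv fM vf.
have one f : f \in M -> (u \in f) || (v \in f) ->
    dist_le (links G :|: [set f]) 2 u v -> exists P, [/\ P \subset M,
    forall f, f \in P -> (u \in f) || (v \in f),
    \sum_(f in P) rank f < rank e & forall A, P \subset A -> accessible G A u v].
  move=> fM fuv duv; exists [set f]; split; first by rewrite sub1set.
  - by move=> g /set1P ->.
  - by rewrite big_set1 lightM.
  - by move=> A fA; apply: dist_le_sub duv; exact: setUS.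
case: p hp lp sp => [|w [|w' [|//]]] /=.
- move=> _ euv _; have := candidates_pair eE.
  by rewrite /e euv setUid cards1.
(* If the single hop were a matching edge, it would be the blocking pair itself, lighter than
   itself. *)
- rewrite andbT => /setUP[uwL|uwM] wv_eq _; first by apply: none; exists [:: w]; rewrite /= uwL.
  rewrite wv_eq in uwM.
  by have := lightM _ uwM; rewrite !inE eqxx ltnn => /(_ isT).
- rewrite andbT => /andP[uw wv'] ww' _; rewrite {w'}ww' in wv'.
  have path2 A : [set u; w] \in A -> [set w; v] \in A -> dist_le A 2 u v.
    by move=> h1 h2; exists [:: w; v]; rewrite /= h1 h2.
  have uuw : (u \in [set u; w]) || (v \in [set u; w]) by rewrite !inE eqxx.
  have vwv : (u \in [set w; v]) || (v \in [set w; v]) by rewrite !inE eqxx !orbT.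
  case/setUP: uw => [uwL|uwM]; case/setUP: wv' => [wvL|wvM].
  + by apply: none; apply: path2.
  + by apply: (one _ wvM vwv); apply: path2; rewrite !inE ?uwL ?eqxx ?orbT.
  + by apply: (one _ uwM uuw); apply: path2; rewrite !inE ?wvL ?eqxx ?orbT.
  (* Two matching edges sharing [w] coincide, so one edge still suffices as support. *)
  + have e12 : [set u; w] = [set w; v].
      by apply: (@trivIset_eq M _ _ w) => //; rewrite !inE eqxx ?orbT.
    by apply: (one _ uwM uuw); apply: path2; rewrite -?e12 !inE eqxx orbT.
Qed.

Lemma matching_resolve M u v : matching G M -> [set u; v] \in candidates G ->
  matching G (resolve M u v).
Proof.
move=> /andP[/subsetP sM /trivIsetP tM] eE; apply/andP; split.
  apply/subsetP=> f /setU1P[->//|]; rewrite inE => /andP[fM _]; exact: sM.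
have disj f : (u \notin f) && (v \notin f) -> [disjoint [set u; v] & f].
  case/andP=> uf vf; apply/pred0P=> x /=; apply/negbTE/negP => /andP[].
  by rewrite !inE => /orP[]/eqP->; apply/negP.
apply/trivIsetP=> f g /setU1P[->|]; rewrite ?inE.
  by case/orP=> [/eqP->|/andP[_ /disj //]]; rewrite eqxx.
case/andP=> fM fd /orP[/eqP->|/andP[gM _]]; last exact: tM.
by rewrite disjoint_sym disj.
Qed.

Definition kept A u v : {set {set V}} :=
  [set f in A | (u \notin f) && (v \notin f)].

(* Bounds the length of the destroyer chain of [e], each link of which is
   charged [#|candidates G|] for the predecessor chain it requires. *)
Definition chain_cost e : nat := #|candidates G| * (#|candidates G|.+1 - rank e).

Lemma chain_cost_pay A e : e \in candidates G -> A != set0 ->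
  (forall f, f \in A -> (weight G f < weight G e)%R) ->
  chain_cost e + \sum_(f in A) rank f <= \sum_(f in A) chain_cost f.
Proof.
move=> eE /set0Pn[a aA] lightA.
rewrite (bigD1 a) //= [leqRHS](bigD1 a) //= addnA; apply: leq_add.
  have := rank_lt eE (lightA _ aA).
  have := rank_le e; have := rank_le a; rewrite /chain_cost; nia.
apply: leq_sum => f _; have := rank_le f; rewrite /chain_cost; nia.
Qed.

(* [A] collects the members of [M] whose destroyers have to be kept, and [A']
   those members of [M] that the pruned sequence actually uses. *)
Lemma pruned_sequence n M Mstar : improvement_sequence G n M Mstar ->
  matching G M -> forall A, A \subset M ->
  exists A' k, [/\ A \subset A', A' \subset M, improvement_sequence G k A' Mstar &
    k + \sum_(f in A') rank f
      <= \sum_(f in A) chain_cost f + \sum_(f in Mstar) rank f].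
Proof.
elim=> {n M Mstar} [M|n M M1 Mstar [u [v [bl ->]]] _ IH] mM A sAM.
  by exists M, 0; split=> //; [exact: improvement_nil | rewrite leq_addl].
have tM : trivIset M by case/andP: mM.
have [P [sPM meetP ltP accP]] := blocking_pair_support tM bl.
have [eE _ wu wv] := bl.
set e := [set u; v] in eE ltP wu wv.
pose D := A :\: kept A u v.
have inD f : f \in D -> [/\ f \in A, f \in M & (u \in f) || (v \in f)].
  rewrite !inE => /andP[nf fA]; split=> //; first exact: (subsetP sAM).
  by move: nf; rewrite fA /= negb_and !negbK.
have lightD f : f \in D -> (weight G f < weight G e)%R.
  case/inD=> _ fM /orP[uf|vf].
    exact: would_improve_lt tM wu fM uf.
  exact: would_improve_lt tM wv fM vf.
have splitA F : \sum_(f in A) F f = \sum_(f in kept A u v) F f + \sum_(f in D) F f :> nat.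
  rewrite (big_setID (kept A u v)) /=; congr (_ + _).
  by apply: eq_bigl => f; rewrite !inE; case: (f \in A).
(* After the step, [e] is demanded only if it destroys some member of [A]. *)
pose A1 := kept A u v :|: (if D == set0 then set0 else [set e]).
have sA1 : A1 \subset resolve M u v.
  apply/subsetP=> f /setUP[|].
    by rewrite !inE => /andP[/(subsetP sAM)-> ->]; rewrite orbT.
  by case: ifP => _; rewrite !inE // => ->.
have costA1 :
    \sum_(f in A1) chain_cost f + \sum_(f in D) rank f <= \sum_(f in A) chain_cost f.
  rewrite splitA /A1; case: eqP => [->|/eqP D0]; first by rewrite setU0 !big_set0.
  have /leq_trans := leq_sum_setU (kept A u v) [set e] chain_cost.
  move=> /(_ _ (leqnn _)); rewrite big_set1.
  have := chain_cost_pay eE D0 lightD; lia.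
have [A1' [k [sA1' sA1'M seq le_k]]] := IH (matching_resolve mM eE) _ sA1.
(* If the pruned tail does not use [e], the step is skipped; [D] is then empty, so nothing in [A]
   awaits destruction here. *)
have [eA1'|eA1'] := boolP (e \in A1'); last first.
  have D0 : D = set0.
    apply/eqP; apply: contraNT eA1' => D0; apply: (subsetP sA1').
    by rewrite /A1 (negbTE D0); apply/setUP; right; exact: set11.
  have sAk : A \subset kept A u v by rewrite -setD_eq0 -/D D0.
  exists A1', k; split=> //.
  - apply: subset_trans sA1'; apply: subset_trans sAk _; exact: subsetUl.
  - apply/subsetP=> f fA1'; have /setU1P[fe|] := subsetP sA1'M _ fA1'.
      by rewrite -/e in fe; rewrite fe (negbTE eA1') in fA1'.
    by rewrite inE => /andP[].
  - move: costA1 le_k; lia.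
(* Otherwise the step is kept. [D] and [P] meet [e], so resolving [e] in [A'] removes exactly these
   and yields [A1']. *)
pose A' := (A1' :\ e) :|: (D :|: P).
have sA'M : A' \subset M.
  apply/subsetP=> f /setUP[/setD1P[ne fA1']|/setUP[/inD[]//|/(subsetP sPM)//]].
  have /setU1P[fe|] := subsetP sA1'M _ fA1'; first by rewrite fe eqxx in ne.
  by rewrite inE => /andP[].
have e_meets f : (u \notin f) && (v \notin f) -> f != e.
  by case/andP=> uf _; apply: contraNneq uf => ->; rewrite !inE eqxx.
exists A', k.+1; split=> //.
- apply/subsetP=> f fA; have [fk|nfk] := boolP (f \in kept A u v); last first.
    by apply/setUP; right; apply/setUP; left; apply/setDP.
  apply/setUP; left; apply/setD1P; split.
    by apply: e_meets; move: fk; rewrite inE => /andP[].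
  by apply: (subsetP sA1'); apply/setUP; left.
- apply: improvement_cons seq; exists u, v; split.
    split=> //; first by apply: accP; rewrite /A' setUA subsetUr.
      exact: would_improve_sub wu.
    exact: would_improve_sub wv.
  apply/setP=> f; apply/idP/setU1P=> [fA1'|[->//|]].
    have [->|ne] := eqVneq f e; [by left | right; rewrite inE].
    have /setU1P[fe|] := subsetP sA1'M _ fA1'; first by rewrite fe eqxx in ne.
    by rewrite !inE ne fA1' => /andP[_ ->].
  rewrite inE => /andP[/setUP[/setD1P[]//|/setUP[/inD[_ _ fuv]|/meetP fuv]]];
    by rewrite -negb_or fuv.
(* Trading [rank e] for the smaller rank sum of [P] frees one unit for the new step; the ranks of
   [D] are paid by [costA1]. *)
- have := leq_sum_setU (A1' :\ e) (D :|: P) rank.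
  have := leq_sum_setU D P rank.
  move: le_k; rewrite (big_setD1 e) //= -/A'.
  move: costA1 ltP.
  move: (\sum_(f in P) _) (\sum_(f in D) _) (\sum_(f in A') _) => sP sD sA'.
  move: (\sum_(f in A1' :\ e) _) (\sum_(f in D :|: P) _) (rank e).
  move: (\sum_(f in A1) _) (\sum_(f in A) _) (\sum_(f in Mstar) _); clear; lia.
Qed.

End Pruning.

Theorem theorem4 :
  exists C : nat,
  forall (R : realType) (V : finType) (G : network_game R V)
    (Mstar M0 : {set {set V}}),
    locally_stable G Mstar ->
    matching G M0 ->
    (exists n : nat, improvement_sequence G n M0 Mstar) ->
    exists n : nat,
      n <= C * #|candidates G| ^ 3 /\ improvement_sequence G n M0 Mstar.
Proof.
(* With [m] candidates, the chain costs of [M0] and the ranks of [Mstar] total at most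
   [m * (m * m.+1) + m * m], which is at most [3 * m ^ 3]. *)
exists 3 => R V G Mstar M0 [mstar _] m0 [n seq].
(* Demanding all of [M0] forces the pruned sequence to start at [M0] itself. *)
have [A' [k [sM0A' sA'M0 seqk le_k]]] := pruned_sequence seq m0 (subxx M0).
have eA' : A' = M0 by apply/eqP; rewrite eqEsubset sA'M0.
rewrite {A'}eA' in seqk le_k sM0A' sA'M0.
exists k; split=> //; set m := #|candidates G|.
have bound M (F : {set V} -> nat) c : matching G M -> (forall f, F f <= c) ->
    \sum_(f in M) F f <= m * c.
  move=> /andP[sM _] leF; apply: (@leq_trans (\sum_(f in M) c)).
    by apply: leq_sum => f _; exact: leF.
  by rewrite sum_nat_const leq_mul2r (subset_leq_card sM) orbT.
have := bound _ _ _ mstar (rank_le G).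
have : \sum_(f in M0) chain_cost G f <= m * (m * m.+1).
  by apply: bound m0 _ => f; rewrite leq_mul2l leq_subr orbT.
move: le_k; rewrite -/m !expnS expn0; nia.
Qed.
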